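(* Fix integers $2 \le d \le n$. For an integer $m \ge n$ and a prime power $q$, denote by $N_{q,m}$ the number of $\mathbb{F}_q$-linear subspaces (rank metric codes) $\mathcal{C} \le \mathbb{F}_q^{n \times m}$ of $\mathbb{F}_q$-dimension $m(n-d+1)$, and by $N'_{q,m}$ the number of such codes of minimum rank distance at most $d-1$. Then for every real number $\varepsilon>0$ there exists $q_\varepsilon \in \mathbb{N}$ such that $$\frac{N'_{q,m}}{N_{q,m}} \ge \frac{1}{2}-\varepsilon \qquad \text{for all integers } m \ge n \text{ and all prime powers } q \ge q_\varepsilon.$$ Moreover, for every real number $\varepsilon>0$ there exists $m_\varepsilon \in \mathbb{N}$ such that $$\frac{N'_{q,m}}{N_{q,m}} \ge \frac{1}{2}\left(\frac{q}{q-1}-(q-1)^{-2}\right)-\varepsilon \qquad \text{for all prime powers } q \text{ and all integers } m \ge n \text{ with } m \ge m_\varepsilon.$$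
   Context: The rank distance between $x,y \in \mathbb{F}_q^{n\times m}$ is $\mathrm{rk}(x-y)$. The minimum rank distance of a non-zero linear code $\mathcal{C} \le \mathbb{F}_q^{n\times m}$ is the minimum rank of a non-zero matrix in $\mathcal{C}$. *)

(* Defs.v *)
From HB Require Import structures.
From mathcomp Require Import all_boot all_order all_algebra.
From mathcomp Require Import reals.

Set Implicit Arguments.
Unset Strict Implicit.
Unset Printing Implicit Defensive.

Import GRing.Theory Num.Theory.

(* vector.v has no finType instance on subspaces over a finite field, which
   counting them requires; the subType structure on {vspace vT} is only visible
   inside VectorInternalTheory. *)
Section FiniteVspace.
Import VectorInternalTheory.

HB.instance Definition _ (F : finFieldType) (vT : vectType F) :=
  [Countable of {vspace vT} by <:].
HB.instance Definition _ (F : finFieldType) (vT : vectType F) :=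
  [Finite of {vspace vT} by <:].

End FiniteVspace.

Local Open Scope ring_scope.

(* The starting candidate vpick C is a nonzero element of C as soon as C is
   nonzero, so this is the minimum of \rank A over the nonzero A in C; on the
   zero code it takes the junk value 0. *)
Definition min_rank_dist (F : finFieldType) (n m : nat)
    (C : {vspace 'M[F]_(n, m)}) : nat :=
  \rank [arg min_(A < vpick C | (A \in C) && (A != 0)) \rank A].

Definition num_codes (F : finFieldType) (n d m : nat) : nat :=
  #|[set C : {vspace 'M[F]_(n, m)} | \dim C == (m * (n - d + 1))%N]|.

Definition num_codes_small_dist (F : finFieldType) (n d m : nat) : nat :=
  #|[set C : {vspace 'M[F]_(n, m)} |
      (\dim C == (m * (n - d + 1))%N) && (min_rank_dist C <= d - 1)%N]|.

(* Main.v *)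
Require Import Defs.
From HB Require Import structures.
From mathcomp Require Import all_boot all_order all_algebra finfield.
From mathcomp Require Import reals.
From mathcomp Require Import zify ring lra.

Import Order.TTheory GRing.Theory Num.Theory.
Local Open Scope ring_scope.

(** The second moment method. Write q = #|F|, k = m(n-d+1), and let S be a set
    of nonzero matrices of rank at most d-1. The general linear group of
    F^(n x m) is transitive on free families of a given size, so double counting
    shows that a uniformly random k-dimensional code contains a given nonzero
    matrix with probability p = (q^k-1)/(q^(nm)-1) and two independent matrices
    with probability at most p^2. With mu = p |S| the number X of elements of S
    in the code has mean mu and E[X^2] <= (q-1) mu + mu^2, whence
    P(X > 0) >= mu / (q-1+mu).
    It suffices to take for S the matrices whose first d-2 rows are arbitrary,
    whose next two rows span a line, and whose other rows vanish: then
    |S| = (q+1) (q^m-1) q^(m(d-2)) and mu >= (q+1) (1-2/q^m). This is at least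
    q-1, so the ratio is always at least 1/2; and the ratio is at least
    (q+1)/(2q) - 2/q^m, where (q+1)/q exceeds q/(q-1) - (q-1)^-2 by
    1/(q(q-1)^2). *)

(** * Free families and their automorphisms *)

(** Both families extend to bases by a basis of a complement of their span. The linear map matching
    these bases is onto, hence injective by rank-nullity. *)
Lemma exists_automorphism_of_free (K : fieldType) (vT : vectType K)
    (X Y : seq vT) :
  free X -> free Y -> size X = size Y ->
  exists2 f : 'End(vT), lker f == 0%VS & map f X = Y.
Proof.
move=> freeX freeY szXY.
pose ext (Z : seq vT) := Z ++ vbasis (<<Z>>^C)%VS.
have ext_basis Z : free Z -> basis_of fullv (ext Z).
  move=> freeZ; rewrite -(addv_complf <<Z>>%VS).
  apply: cat_basis; last exact: vbasisP.
    by apply/directv_addP; apply: capv_compl.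
  by rewrite /basis_of eqxx.
have sz_ext : size (ext Y) = size (ext X).
  by rewrite !size_cat !size_tuple !dimv_compl (eqP freeX) (eqP freeY) szXY.
have [g gE] := linear_of_free (ext X) (ext Y).
pose f : 'End(vT) := linfun g.
have fE : map f (ext X) = ext Y.
  rewrite -(gE (basis_free (ext_basis X freeX)) sz_ext).
  by apply: eq_map => v; rewrite lfunE.
exists f; last first.
  move: fE; rewrite map_cat => /eqP.
  by rewrite eqseq_cat ?size_map // => /andP[/eqP].
have im_f : (f @: fullv = fullv)%VS.
  rewrite -{1}(span_basis (ext_basis X freeX)) limg_span fE.
  exact: span_basis (ext_basis Y freeY).
have := limg_ker_dim f fullv; rewrite capfv im_f -dimv_eq0 => /eqP.
by rewrite -{2}[\dim fullv]add0n eqn_add2r.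
Qed.

(** Each new vector is chosen in [U] outside the span of the [i] earlier ones, which has [#|F| ^ i]
    elements. If [r] exceeds [\dim U], the factor at [i = \dim U] is 0. *)
Lemma card_free_tuples (F : finFieldType) (n m r : nat)
    (U : {vspace 'M[F]_(n, m)}) :
  #|[set X : r.-tuple 'M[F]_(n, m) | free X & (<<X>> <= U)%VS]| =
  (\prod_(i < r) (#|F| ^ \dim U - #|F| ^ i))%N.
Proof.
elim: r => [|r IHr].
  rewrite big_ord0; apply/eqP/cards1P; exists [tuple].
  by apply/setP=> X; rewrite !inE tuple0 nil_free span_nil sub0v.
rewrite big_ord_recr /= -IHr.
set S := [set X : r.-tuple _ | _].
pose D := [set p : r.-tuple 'M[F]_(n, m) * 'M[F]_(n, m) |
  (p.1 \in S) && (p.2 \in U) && (p.2 \notin <<p.1>>%VS)].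
have -> : [set X : r.+1.-tuple 'M[F]_(n, m) | free X & (<<X>> <= U)%VS] =
    [set cons_tuple p.2 p.1 | p in D].
  apply/setP=> X; apply/idP/imsetP => [|[[Y v]]].
    case/tupleP: X => v Y; rewrite inE /= free_cons span_cons subv_add.
    case/andP=> /andP[vY fY] /andP[vU YU].
    by exists (Y, v); rewrite // !inE fY YU vY -memvE in vU *; rewrite vU.
  rewrite !inE /= => /andP[/andP[/andP[fY YU] vU] vY] ->.
  by rewrite /= free_cons span_cons subv_add vY fY YU -memvE vU.
rewrite card_imset; last first.
  move=> [X u] [Y v] /(congr1 val) /= [-> eXY].
  by congr (_, _); apply: val_inj.
rewrite -sum1_card (eq_bigl (fun p : _ * _ => (p.1 \in S) &&
    ((p.2 \in U) && (p.2 \notin <<p.1>>%VS)))); last first.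
  by move=> p; rewrite inE -andbA.
rewrite -(pair_big_dep (mem S) (fun X v => (v \in U) && (v \notin <<X>>%VS))
  (fun _ _ => 1%N)) /=.
rewrite (eq_bigr (fun=> #|F| ^ \dim U - #|F| ^ r)%N).
  by rewrite sum_nat_const.
move=> X; rewrite inE => /andP[fX XU].
rewrite sum1dep_card.
have -> : [set v | (v \in U) && (v \notin <<X>>%VS)] =
    [set v in U] :\: [set v in <<X>>%VS].
  by apply/setP=> v; rewrite !inE andbC.
rewrite cardsD (setIidPr _); last first.
  by apply/subsetP=> v; rewrite !inE; apply: (subvP XU).
rewrite !cardsE !card_vspace; congr (_ - _ ^ _)%N.
by move: fX; rewrite /free size_tuple => /eqP.
Qed.

(** * Codes containing a given free family *)

Definition codes (F : finFieldType) (n m k : nat) :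
    {set {vspace 'M[F]_(n, m)}} := [set C | \dim C == k].

Lemma codes_gt0 (F : finFieldType) (n m k : nat) :
  (k <= n * m)%N -> (0 < #|codes F n m k|)%N.
Proof.
move=> le_k; apply/card_gt0P.
exists <<take k (vbasis {: 'M[F]_(n, m)})>>%VS; rewrite inE.
have := basis_free (vbasisP {: 'M[F]_(n, m)}).
rewrite -{1}(cat_take_drop k (vbasis _)) cat_free => /and3P[fr _ _].
by rewrite (eqP fr) size_takel // size_tuple dimvf.
Qed.

Definition codes_over {F : finFieldType} {n m : nat} (k : nat)
    (X : seq 'M[F]_(n, m)) := [set C in codes F n m k | (<<X>> <= C)%VS].

(** An automorphism carrying [X] to [Y] acts injectively on codes and keeps their dimension.
    Exchanging [X] and [Y] gives equality. *)
Lemma card_codes_over_le (F : finFieldType) (n m k : nat)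
    (X Y : seq 'M[F]_(n, m)) :
  free X -> free Y -> size X = size Y ->
  (#|codes_over k X| <= #|codes_over k Y|)%N.
Proof.
move=> fX fY eXY.
have [f kf fXY] := exists_automorphism_of_free _ _ _ _ fX fY eXY.
have inj_f : injective (fun C : {vspace 'M[F]_(n, m)} => (f @: C)%VS).
  move=> C D /= eCD.
  have K W : (f^-1 @: (f @: W))%VS = W.
    by rewrite -limg_comp lker0_compVf // lim1g.
  by rewrite -(K C) eCD K.
rewrite -(card_imset _ inj_f); apply/subset_leq_card/subsetP.
move=> _ /imsetP[C + ->]; rewrite !inE => /andP[/eqP dC XC].
rewrite limg_dim_eq ?dC ?eqxx /=; last by rewrite (eqP kf) capv0.
by rewrite -fXY -limg_span limgS.
Qed.

(** Double counting of the pairs of a free family [Y] of the size of [X] and a code containing it: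
    by transitivity every [Y] lies in as many codes as [X]. *)
Lemma card_codes_over (F : finFieldType) (n m k : nat)
    (X : seq 'M[F]_(n, m)) : free X ->
  (#|codes_over k X| * \prod_(i < size X) (#|F| ^ (n * m) - #|F| ^ i) =
   #|codes F n m k| * \prod_(i < size X) (#|F| ^ k - #|F| ^ i))%N.
Proof.
move=> fX; set r := size X.
have -> : (n * m)%N = \dim {: 'M[F]_(n, m)} by rewrite dimvf.
rewrite -card_free_tuples.
transitivity (\sum_(Y in [set Y : r.-tuple 'M[F]_(n, m) |
    free Y & (<<Y>> <= fullv)%VS]) #|codes_over k Y|)%N.
  rewrite mulnC -sum_nat_const; apply: eq_bigr => Y; rewrite inE subvf andbT.
  by move=> fY; apply/eqP; rewrite eqn_leq !card_codes_over_le ?size_tuple.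
under eq_bigr do rewrite -sum1dep_card.
rewrite (exchange_big_dep (mem (codes F n m k))) /=; last first.
  by move=> Y C _ /andP[].
rewrite -sum_nat_const; apply: eq_bigr => C; rewrite inE => /eqP <-.
rewrite sum1dep_card -card_free_tuples; apply: eq_card => Y.
by rewrite !inE eqxx subvf /= andbT.
Qed.

Lemma card_codes_over1 (R : realFieldType) (F : finFieldType) (n m k : nat)
    (v : 'M[F]_(n, m)) : v != 0 ->
  #|codes_over k [:: v]|%:R =
  #|codes F n m k|%:R * ((#|F|%:R ^+ k - 1) / (#|F|%:R ^+ (n * m) - 1)) :> R.
Proof.
move=> v0; have fv : free [:: v] by rewrite seq1_free.
have := card_codes_over F n m k [:: v] fv.
rewrite !big_ord_recl !big_ord0 !muln1 => /(congr1 (fun x => x%:R : R)).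
have q1 := finNzRing_gt1 F.
rewrite !natrM !natrB ?expn_gt0 ?(ltnW q1) // !natrX expr0 => e.
have nm_gt0 : (0 < n * m)%N.
  rewrite -[(n * m)%N]/(dim 'M[F]_(n, m)) -dimvf.
  apply: (@leq_trans (\dim <[v]>)); first by rewrite dim_vline v0.
  by rewrite dimvS ?subvf.
have Q1 : (1 : R) < #|F|%:R ^+ (n * m) by rewrite exprn_egt1 ?ltr1n -?lt0n.
by rewrite mulrA -e mulfK // subr_eq0 gt_eqF.
Qed.

(** With P = q^k and Q = q^(nm), the exact probability is (P-1)(P-q) / ((Q-1)(Q-q)), and (P-q)/(Q-q)
    <= (P-1)/(Q-1) because P <= Q. *)
Lemma card_codes_over2_le (R : realFieldType) (F : finFieldType)
    (n m k : nat) (u v : 'M[F]_(n, m)) :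
  (0 < k <= n * m)%N -> free [:: u; v] ->
  #|codes_over k [:: u; v]|%:R <=
  #|codes F n m k|%:R *
    ((#|F|%:R ^+ k - 1) / (#|F|%:R ^+ (n * m) - 1)) ^+ 2 :> R.
Proof.
move=> /andP[k0 knm] fuv.
have := card_codes_over F n m k [:: u; v] fuv.
rewrite !big_ord_recl !big_ord0 !muln1 /= => /(congr1 (fun x => x%:R : R)).
have q1 := finNzRing_gt1 F.
have nm2 : (1 < n * m)%N.
  rewrite -[(n * m)%N]/(dim 'M[F]_(n, m)) -dimvf.
  apply: (@leq_trans (\dim <<[:: u; v]>>%VS)); first by rewrite (eqP fuv).
  by rewrite dimvS ?subvf.
have leq1 i : (0 < i)%N -> (#|F| ^ 1 <= #|F| ^ i)%N.
  by move=> i0; rewrite leq_exp2l.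
rewrite /bump /= addn0 !natrM !natrB ?expn_gt0 ?(ltnW q1) ?leq1 ?(ltnW nm2) //.
rewrite !natrX expr0 expr1.
set q : R := #|F|%:R; set Q := q ^+ (n * m); set P := q ^+ k.
set A := _%:R; set M := _%:R => e.
have A0 : 0 <= A by [].
have q1' : 1 < q by rewrite ltr1n.
have QP : P <= Q by rewrite ler_eXn2l.
have Qq : q < Q by rewrite -[X in X < _]expr1 ltr_eXn2l.
have Pq : q <= P by rewrite -[X in X <= _]expr1 ler_eXn2l.
have M0 : 0 <= M by [].
rewrite expr_div_n mulrA ler_pdivlMr; last by rewrite exprn_gt0; lra.
rewrite -(@ler_pM2r _ (Q - q)); last by lra.
have -> : A * (Q - 1) ^+ 2 * (Q - q) = M * (P - 1) * ((P - q) * (Q - 1)).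
  transitivity (A * ((Q - 1) * (Q - q)) * (Q - 1)); first by ring.
  by rewrite e; ring.
have -> : M * (P - 1) ^+ 2 * (Q - q) = M * (P - 1) * ((P - 1) * (Q - q)) by ring.
apply: ler_wpM2l; first by apply: mulr_ge0 => //; lra.
(* This product equals (P-1)(Q-q) - (P-q)(Q-1). *)
have : 0 <= (q - 1) * (Q - P) by apply: mulr_ge0; lra.
lra.
Qed.

(** * The second moment bound *)

Definition codes_meeting {F : finFieldType} {n m : nat} (k : nat)
    (S : {set 'M[F]_(n, m)}) :=
  [set C in codes F n m k | [exists A in S, A \in C]].

Lemma second_moment_codes (R : realFieldType) (F : finFieldType)
    (n m k : nat) (S : {set 'M[F]_(n, m)})
    (mu : R := #|S|%:R * ((#|F|%:R ^+ k - 1) / (#|F|%:R ^+ (n * m) - 1))) :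
  (0 < k <= n * m)%N -> 0 \notin S -> 0 < mu ->
  mu / (#|F|%:R - 1 + mu) <=
    #|codes_meeting k S|%:R / #|codes F n m k|%:R.
Proof.
move=> knm S0 mu0; set q : R := #|F|%:R; pose p : R := (q ^+ k - 1) / (q ^+ (n * m) - 1).
have muE : mu = #|S|%:R * p by [].
clearbody mu.
have [k0 lekm] := andP knm.
set M : R := #|codes F n m k|%:R.
have M0 : 0 < M by rewrite ltr0n codes_gt0.
have q1 : 1 < q by rewrite ltr1n finNzRing_gt1.
have p0 : 0 < p.
  by apply: divr_gt0; rewrite subr_gt0 exprn_egt1 // -lt0n // (leq_trans k0).
pose X (C : {vspace 'M[F]_(n, m)}) : R := \sum_(v in S) (v \in C)%:R.
have sum_mem v : v \in S -> \sum_(C in codes F n m k) (v \in C)%:R = M * p.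
  move=> vS; have v0 : v != 0 by apply: contraNneq S0 => <-.
  rewrite -[RHS](card_codes_over1 R F n m k v v0).
  rewrite -natr_sum -big_mkcondr /= sum1dep_card; congr (_%:R).
  by apply: eq_card => C; rewrite !inE span_seq1 -memvE.
have EX : \sum_(C in codes F n m k) X C = M * mu.
  rewrite exchange_big /= (eq_bigr (fun=> M * p)) //.
  by rewrite sumr_const -mulr_natl muE mulrCA.
have EX2 : \sum_(C in codes F n m k) X C ^+ 2 <= M * ((q - 1) * mu + mu ^+ 2).
  under eq_bigr do rewrite expr2 mulr_suml.
  rewrite exchange_big /=.
  have -> : M * ((q - 1) * mu + mu ^+ 2) =
      \sum_(u in S) (M * p * (q - 1) + M * p * mu).
    by rewrite sumr_const -mulr_natl muE; ring.
  apply: ler_sum => u uS.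
  have u0 : u != 0 by apply: contraNneq S0 => <-.
  under eq_bigr do rewrite mulr_sumr.
  (* At most q-1 elements of [S] lie on the line of [u], as 0 is excluded, and each contributes at
     most [M * p]. Any other [v] is independent of [u] and contributes at most [M * p ^+ 2]. *)
  rewrite exchange_big /= (bigID (fun v => v \in <[u]>%VS)) /=.
  apply: lerD.
    apply: (@le_trans _ _ (\sum_(v in S | v \in <[u]>%VS) (M * p))).
      apply: ler_sum => v _; rewrite -(sum_mem u uS) ler_sum // => C _.
      by case: (u \in C); case: (v \in C); rewrite ?mulr0 ?mulr1 ?ler01.
    rewrite sumr_const -mulr_natl mulrC ler_wpM2l //.
      by rewrite mulr_ge0 // ltW.
    have -> : q - 1 = (#|F| - 1)%:R by rewrite natrB // ltnW ?finNzRing_gt1.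
    rewrite ler_nat.
    have -> : #|F| = #|<[u]>%VS| by rewrite card_vspace dim_vline u0 expn1.
    rewrite (cardD1 0 <[u]>%VS) mem0v addKn.
    apply/subset_leq_card/subsetP => v; rewrite !inE => /andP[vS ->].
    by rewrite andbT; apply: contraNneq S0 => <-.
  apply: (@le_trans _ _ (\sum_(v in S | v \notin <[u]>%VS) (M * p ^+ 2))).
    apply: ler_sum => v /andP[vS vu].
    have fuv : free [:: v; u] by rewrite free_cons span_seq1 vu seq1_free.
    apply: le_trans (card_codes_over2_le R F n m k v u knm fuv).
    rewrite [leLHS](_ : _ = #|codes_over k [:: v; u]|%:R) //.
    under eq_bigr do rewrite -natrM mulnb.
    rewrite -natr_sum -big_mkcondr /= sum1dep_card; congr (_%:R).
    apply: eq_card => C; rewrite !inE span_cons span_seq1 subv_add -!memvE.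
    by rewrite [(v \in C) && _]andbC.
  rewrite sumr_const -mulr_natl muE.
  have -> : M * p * (#|S|%:R * p) = #|S|%:R * (M * p ^+ 2) by ring.
  apply: ler_wpM2r; first by rewrite mulr_ge0 ?exprn_ge0 // ltW.
  by rewrite ler_nat; apply/subset_leq_card/subsetP => v /andP[].
rewrite ler_pdivlMr //.
(* This [t] maximises 2 t mu - t^2 ((q-1) mu + mu^2), with value mu/(q-1+mu). *)
pose t := (q - 1 + mu)^-1.
have s0 : 0 < q - 1 + mu by lra.
(* Pointwise, [X C > 0] >= 2 t X C - (t X C)^2 *)
apply: (@le_trans _ _ (\sum_(C in codes F n m k) (t *+ 2 * X C - t ^+ 2 * X C ^+ 2))).
  rewrite sumrB -!mulr_sumr EX.
  apply: (@le_trans _ _ (t *+ 2 * (M * mu) - t ^+ 2 * (M * ((q - 1) * mu + mu ^+ 2)))).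
    rewrite le_eqVlt; apply/orP; left; apply/eqP.
    rewrite /t; field; lra.
  by rewrite lerD2l lerN2 ler_wpM2l // exprn_ge0 // invr_ge0 ltW.
rewrite [leRHS](_ : _ =
    \sum_(C in codes F n m k) [exists A in S, A \in C]%:R); last first.
  rewrite -natr_sum -big_mkcondr /= sum1dep_card; congr (_%:R).
apply: ler_sum => C _; case: existsP => [_|noA] /=.
  by have := sqr_ge0 (t * X C - 1); lra.
rewrite /X big1 ?mulr0 ?expr0n ?mulr0 ?subr0 // => v vS.
case vC: (v \in C) => //; case: noA; exists v; by rewrite vS.
Qed.

(** * A large set of matrices of small rank *)

Lemma min_rank_dist_le (F : finFieldType) (n m : nat)
    (C : {vspace 'M[F]_(n, m)}) (A : 'M[F]_(n, m)) :
  A \in C -> A != 0 -> (min_rank_dist C <= \rank A)%N.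
Proof.
move=> AC A0; rewrite /min_rank_dist; case: arg_minnP => [|B _ minB].
  rewrite memv_pick vpick0; apply: contraNneq A0 => C0.
  by rewrite -memv0 -C0.
by apply: minB; rewrite AC A0.
Qed.

(* The parameter [x] runs through the projective line, [None] being (0 : 1). *)
Definition pencil_mx (F : finFieldType) (e r m : nat)
    (x : option F) (B : 'M[F]_(e, m)) (w : 'rV[F]_m) :
    'M[F]_(e + (1 + (1 + r)), m) :=
  if x is Some a then col_mx B (col_mx w (col_mx (a *: w) 0))
  else col_mx B (col_mx 0 (col_mx w 0)).

Lemma pencil_mx_neq0 (F : finFieldType) (e r m : nat)
    (x : option F) (B : 'M[F]_(e, m)) (w : 'rV[F]_m) :
  w != 0 -> pencil_mx F e r m x B w != 0.
Proof.
apply: contra_neq; rewrite /pencil_mx -!col_mx0.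
case: x => [a|] /eq_col_mx[_]; first by case/eq_col_mx.
by case/eq_col_mx=> _ /eq_col_mx[].
Qed.

(** All rows lie in the row space of [col_mx B w], which has only e+1 rows. *)
Lemma rank_pencil_mx (F : finFieldType) (e r m : nat)
    (x : option F) (B : 'M[F]_(e, m)) (w : 'rV[F]_m) :
  (\rank (pencil_mx F e r m x B w) <= e.+1)%N.
Proof.
have sub : (pencil_mx F e r m x B w <= col_mx B w)%MS.
  have Bs : (B <= col_mx B w)%MS by rewrite -addsmxE addsmxSl.
  have ws : (w <= col_mx B w)%MS by rewrite -addsmxE addsmxSr.
  by case: x => [a|]; rewrite !col_mx_sub Bs ?scalemx_sub ?ws ?sub0mx.
rewrite (leq_trans (mxrankS sub)) //.
by have := rank_leq_row (col_mx B w); rewrite [X in (_ <= X)%N]addn1.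
Qed.

(** The two rows below [B] are (w, a w) or (0, w) with w nonzero. Whether the first vanishes tells
    the cases apart, and then w and a can be read off. *)
Lemma pencil_mx_inj (F : finFieldType) (e r m : nat) (x y : option F)
    (B C : 'M[F]_(e, m)) (v w : 'rV[F]_m) : v != 0 -> w != 0 ->
  pencil_mx F e r m x B v = pencil_mx F e r m y C w ->
  [/\ x = y, B = C & v = w].
Proof.
move=> v0 w0; case: x y => [a|] [b|] /eq_col_mx[-> /eq_col_mx[vw]].
- subst w => /eq_col_mx[/eqP + _]; rewrite -subr_eq0 -scalerBl scaler_eq0.
  by rewrite (negPf v0) orbF subr_eq0 => /eqP->.
- by rewrite vw eqxx in v0.
- by rewrite -vw eqxx in w0.
- by case/eq_col_mx=> -> _.
Qed.

(** Used with e = d-2 and r = n-d. The projective line supplies the factor q+1; with one fixed row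
    for [w] the mean would be near 1 and the bound only near 1/q. *)
Definition pencils (F : finFieldType) (e r m : nat) :
    {set 'M[F]_(e + (1 + (1 + r)), m)} :=
  [set pencil_mx F e r m p.1.1 p.1.2 p.2 |
    p in setX (setX [set: option F] [set: 'M[F]_(e, m)]) [set~ 0]].

Lemma card_pencils (F : finFieldType) (e r m : nat) :
  #|pencils F e r m| =
  (#|F|.+1 * #|F| ^ (e * m) * (#|F| ^ m - 1))%N.
Proof.
rewrite card_in_imset.
  rewrite !cardsX !cardsT card_option card_mx cardsC1 card_mx mul1n.
  by rewrite subn1.
move=> [[x B] v] [[y C] w]; rewrite !inE /= => v0 w0.
by case/pencil_mx_inj => // -> -> ->.
Qed.

Lemma codes_meeting_pencils_small (F : finFieldType) (e r m k : nat) :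
  {in codes_meeting k (pencils F e r m),
    forall C, (min_rank_dist C <= e.+1)%N}.
Proof.
move=> C; rewrite inE => /andP[_ /existsP[_ /andP[/imsetP[[[x B] w] + ->]]]].
rewrite !inE /= => w0 /min_rank_dist_le le_rk.
by rewrite (leq_trans (le_rk _)) ?rank_pencil_mx ?pencil_mx_neq0.
Qed.

(** * Estimates for the ratio and the two limits *)

(* [E], [M], [K] stand for q^(m(d-2)), q^m and q^k, so that q^(nm) = E M K. *)
Lemma pencil_mean_ge (R : realFieldType) (q E M K : R) :
  1 < q -> 1 <= E -> 2 <= M -> M <= K ->
  (q + 1) * (1 - 2 / M) <=
    (q + 1) * E * (M - 1) * ((K - 1) / (E * (M * K) - 1)).
Proof.
move=> q1 E1 M2 MK.
have MK0 : 0 < M * K by apply: mulr_gt0; lra.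
have MK4 : 2 * 2 <= M * K by apply: ler_pM; lra.
have EMK : M * K <= E * (M * K) by rewrite ler_peMl // ltW.
have -> : (q + 1) * E * (M - 1) * ((K - 1) / (E * (M * K) - 1)) =
    (q + 1) * ((E * (M - 1) * (K - 1)) / (E * (M * K) - 1)).
  by field; lra.
apply: ler_wpM2l; first lra.
(* Enlarging the denominator to E M K cancels E. What remains is (1-1/M)(1-1/K), at least 1 - 2/M
   since K >= M. *)
apply: (@le_trans _ _ (((M - 1) * (K - 1)) / (M * K))).
  rewrite ler_pdivlMr // -(@ler_pM2l _ M); last lra.
  have -> : M * ((1 - 2 / M) * (M * K)) = (M - 2) * (M * K) by field; lra.
  have : 0 <= M * (K - M) by apply: mulr_ge0; lra.
  by lra.
rewrite ler_pdivrMr // mulrAC ler_pdivlMr; last lra.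
have : 0 <= (M - 1) * (K - 1) by apply: mulr_ge0; lra.
lra.
Qed.

Lemma codes_small_ratio_ge (R : realFieldType) (F : finFieldType)
    (n d m : nat) : (2 <= d <= n)%N -> (0 < m)%N ->
  let a : R := (#|F|%:R + 1) * (1 - 2 / #|F|%:R ^+ m) in
  0 < a ->
  a / (#|F|%:R - 1 + a) <=
    (num_codes_small_dist F n d m)%:R / (num_codes F n d m)%:R.
Proof.
case/andP; case: d => [|[|e]] // _ le_dn m0 a a0.
have [r nE] : exists r, n = (e + (1 + (1 + r)))%N by exists (n - e.+2)%N; lia.
subst n; have dE : (e + (1 + (1 + r)) - e.+2 + 1 = r.+1)%N by lia.
rewrite /num_codes_small_dist /num_codes dE.
set k := (m * r.+1)%N.
have le_mk : (m <= k)%N by rewrite leq_pmulr.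
have k0 : (0 < k)%N by apply: leq_trans le_mk.
have NE : ((e + (1 + (1 + r))) * m = e * m + (m + k))%N by rewrite /k; ring.
have knm : (0 < k <= (e + (1 + (1 + r))) * m)%N by rewrite k0 NE; lia.
have q1 : (1 : R) < #|F|%:R by rewrite ltr1n finNzRing_gt1.
have q2 : (2 : R) <= #|F|%:R by rewrite ler_nat finNzRing_gt1.
have := second_moment_codes R F _ m k (pencils F e r m) knm.
set mu : R := _ * (_ / _).
have le_amu : a <= mu.
  rewrite /mu card_pencils NE !natrM natrB ?expn_gt0 ?(ltnW (finNzRing_gt1 F)) //.
  rewrite !natrX -addn1 natrD !exprD.
  apply: pencil_mean_ge => //.
  - by rewrite exprn_ege1 // ltW.
  - by rewrite (le_trans q2) // -[leLHS]expr1 ler_eXn2l.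
  - by rewrite ler_eXn2l.
have mu0 : 0 < mu by lra.
have notin0 : 0 \notin pencils F e r m.
  apply/imsetP=> -[[[x B] w]]; rewrite !inE /= => w0 /esym/eqP.
  by apply/negP/pencil_mx_neq0.
move=> /(_ notin0 mu0) le_ratio.
(* x/(q-1+x) increases with x, so the lower bound [a] may replace the mean. *)
apply: (@le_trans _ _ (mu / (#|F|%:R - 1 + mu))).
  rewrite ler_pdivrMr; last lra.
  rewrite mulrAC ler_pdivlMr; last lra.
  have : 0 <= (#|F|%:R - 1) * (mu - a) by apply: mulr_ge0; lra.
  lra.
apply: le_trans le_ratio _.
apply: ler_wpM2r; first by rewrite invr_ge0.
rewrite ler_nat; apply/subset_leq_card/subsetP => C CS.
rewrite inE (codes_meeting_pencils_small _ _ _ _ _ _ CS) andbT.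
by move: CS; rewrite !inE => /andP[].
Qed.

Theorem mainTheorem1 (R : realType) (n d : nat)
    (le2d : (2 <= d)%N) (ledn : (d <= n)%N) :
  (forall eps : R, 0 < eps ->
     exists q_eps : nat, forall (m : nat) (F : finFieldType),
       (n <= m)%N -> (q_eps <= #|F|)%N ->
       (num_codes_small_dist F n d m)%:R / (num_codes F n d m)%:R
         >= 1 / 2 - eps)
  /\
  (forall eps : R, 0 < eps ->
     exists m_eps : nat, forall (F : finFieldType) (m : nat),
       (n <= m)%N -> (m_eps <= m)%N ->
       (num_codes_small_dist F n d m)%:R / (num_codes F n d m)%:R
         >= 1 / 2 * (#|F|%:R / (#|F|%:R - 1) - (#|F|%:R - 1) ^- 2) - eps).
Proof.
have dn : (2 <= d <= n)%N by rewrite le2d.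
split=> eps eps0.
(* The bound 1/2 holds for every q, so any threshold will do. *)
- exists 0%N => m F nm _.
  have m2 : (2 <= m)%N by lia.
  have q2 : (2 : R) <= #|F|%:R by rewrite ler_nat finNzRing_gt1.
  have := codes_small_ratio_ge R F n d m dn (ltnW m2).
  set q : R := #|F|%:R in q2 *; set a := (q + 1) * _ => /= ratio.
  (* q^m >= q^2 >= 2q >= q+1, so [a] falls short of q+1 by at most 2. *)
  have M2 : q ^+ 2 <= q ^+ m by rewrite ler_eXn2l //; lra.
  have qq : 2 * q <= q ^+ 2 by rewrite expr2 ler_wpM2r //; lra.
  have le_qa : q - 1 <= a.
    have -> : a = q + 1 - 2 * ((q + 1) / q ^+ m) by rewrite /a; field; lra.
    have : (q + 1) / q ^+ m <= 1 by rewrite ler_pdivrMr; lra.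
    lra.
  have a0 : 0 < a by lra.
  apply: le_trans (ratio a0).
  by rewrite ler_pdivlMr; nra.
(* As q^m > m, this makes 2/q^m <= eps uniformly in q; the added 2 ensures q^m >= 3, hence [a] >
   0. *)
exists (Num.bound (2 / eps)).+2 => F m nm lem.
have q2 : (2 : R) <= #|F|%:R by rewrite ler_nat finNzRing_gt1.
have m0 : (0 < m)%N by lia.
have := codes_small_ratio_ge R F n d m dn m0.
set q : R := #|F|%:R in q2 *; set a := (q + 1) * _ => /= ratio.
have M_ge : m.+1%:R <= q ^+ m.
  by rewrite -natrX ler_nat ltn_expl // finNzRing_gt1.
have M4 : (3 : R) <= q ^+ m.
  by apply: le_trans M_ge; rewrite ler_nat; lia.
have M_gt : 2 / eps < q ^+ m.
  apply: lt_le_trans (archi_boundP _) (le_trans _ M_ge).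
    by rewrite divr_ge0 // ltW.
  by rewrite ler_nat; lia.
have le_eps : 2 / q ^+ m <= eps.
  rewrite ler_pdivrMr; last lra.
  by rewrite mulrC -ler_pdivrMr // ltW.
have lt1 : 2 / q ^+ m < 1 by rewrite ltr_pdivrMr; lra.
have gt0 : 0 < 2 / q ^+ m by rewrite divr_gt0 //; lra.
set del := 2 / q ^+ m in a ratio le_eps lt1 gt0.
have a0 : 0 < a by rewrite /a mulr_gt0; lra.
apply: le_trans (ratio a0).
(* The denominator q-1+a is at most 2q because a <= q+1. *)
apply: (@le_trans _ _ ((q + 1) * (1 - del) / (2 * q))); last first.
  rewrite -/a; apply: ler_wpM2l; first exact: ltW.
  rewrite lef_pV2 ?posrE; try lra.
  have : 0 <= (q + 1) * del by rewrite mulr_ge0; lra.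
  rewrite /a; lra.
have -> : (q + 1) * (1 - del) / (2 * q) =
    1 / 2 * ((q + 1) / q) - (q + 1) / (2 * q) * del by field; lra.
apply: lerB; last first.
  apply: le_trans le_eps; apply: ler_piMl; first lra.
  by rewrite ler_pdivrMr; lra.
apply: ler_wpM2l; first lra.
rewrite -subr_ge0.
have -> : (q + 1) / q - (q / (q - 1) - (q - 1) ^- 2) =
    (q * (q - 1) ^+ 2)^-1 by field; lra.
by rewrite invr_ge0 mulr_ge0 ?sqr_ge0 //; lra.
Qed.
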